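(* Let $G$ be a compactly generated locally compact second countable (lcsc) group and let $\Lambda\subset G$ be a uniform approximate lattice. Let $\Lambda^\infty$ be the subgroup of $G$ generated by $\Lambda$. Then $\Lambda^\infty$ is finitely generated, and the canonical QI class of $G$ restricts to the canonical QI class of $\Lambda$.
   Context: Approximate subgroup: a subset $\Lambda$ of a group $G$ which is symmetric ($\Lambda=\Lambda^{-1}$), contains the identity, and for which there is a finite set $F\subset\Lambda^\infty$ with $\Lambda^2\subset F\Lambda$, where $\Lambda^\infty$ is the subgroup generated by $\Lambda$ and $\Lambda^2=\{xy: x,y\in\Lambda\}$. Let $d$ be any proper left-invariant metric on $G$ inducing its topology (the notions below do not depend on $d$). $\Lambda\subset G$ is uniformly discrete if there is $r>0$ with $d(x,y)\ge r$ for all distinct $x,y\in\Lambda$; relatively dense if there is $R>0$ such that every $g \in G$ satisfies $d(g,x)<R$ for some $x\in\Lambda$; a Delone set if it is non-empty and both uniformly discrete and relatively dense. A uniform approximate lattice in $G$ is an approximate subgroup which is a Delone set. A map $f:X\to Y$ of metric spaces is a $(K,C)$-quasi-isometric embedding if $\frac1K(d_X(x_1,x_2)-C)\le d_Y(f(x_1),f(x_2))\le K d_X(x_1,x_2)+C$ for all $x_1,x_2$, and a quasi-isometry if moreover some $R$-neighbourhood of $f(X)$ is $Y$. Two metrics on a set are quasi-isometric (in the same QI class) if the identity map is a quasi-isometry between them. The canonical QI class of a compactly generated lcsc group $G$ is the common QI class of all left-invariant word metrics with respect to compact generating sets. If $\Lambda^\infty$ is finitely generated, the canonical QI class of $\Lambda$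 is the QI class of the restrictions to $\Lambda$ of the left-invariant word metrics on $\Lambda^\infty$ with respect to finite generating sets. The restriction of a QI class of metrics to a subset is the QI class of the restricted metrics. *)

(* Defs.v *)
From HB Require Import structures.
From mathcomp Require Import all_boot all_order all_algebra.
From mathcomp Require Import all_classical all_reals all_analysis.

Set Implicit Arguments.
Unset Strict Implicit.
Unset Printing Implicit Defensive.

Import Order.TTheory GRing.Theory Num.Theory.

Local Open Scope classical_set_scope.
Local Open Scope ring_scope.

HB.mixin Record isTopologicalGroup G of Topological G & Group G := {
  mulg_continuous : continuous (fun x : G * G => (x.1 * x.2)%g) ;
  invg_continuous : continuous (fun x : G => (x^-1)%g) ;
}.

#[short(type="topologicalGroupType")]
HB.structure Definition TopologicalGroup :=
  {G of Topological G & Group G & isTopologicalGroup G}.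

Section Groups.
Context {G : groupType}.
Implicit Types (A S : set G).

Definition generated S : set G := smallest (fun A => group_closed [in A]) S.

Definition setmulg A S : set G := [set (x * y)%g | x in A & y in S].

Definition approximate_subgroup A : Prop :=
  [/\ forall x, A x -> A (x^-1)%g,
      A 1%g
    & exists F : set G,
        [/\ finite_set F, F `<=` generated A & setmulg A A `<=` setmulg F A]].

Definition finite_generating_set (H S : set G) : Prop :=
  finite_set S /\ generated S = H.

Definition finitely_generated (H : set G) : Prop :=
  exists S, finite_generating_set H S.

Definition words S (g : G) : set (seq G) :=
  [set s | (forall x, x \in s -> S x \/ S (x^-1)%g) /\ (\prod_(x <- s) x)%g = g].

Variable R : realType.

(* For g outside [generated S] the infimum is over the empty set and equals 0,
   so this is a metric only on the cosets of [generated S]. *)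
Definition word_metric S (x y : G) : R :=
  inf [set (size s)%:R | s in words S (x^-1 * y)%g].

End Groups.

Arguments word_metric {G} R S x y.

Section Metrics.
Context {R : realType}.

Definition is_metric {X : Type} (d : X -> X -> R) : Prop :=
  [/\ forall x y, 0 <= d x y,
      forall x y, d x y = 0 <-> x = y,
      forall x y, d x y = d y x
    & forall x y z, d x z <= d x y + d y z].

Definition quasi_isometric_embedding {X Y : Type}
    (dX : X -> X -> R) (dY : Y -> Y -> R) (f : X -> Y) (K C : R) : Prop :=
  forall x1 x2, K^-1 * (dX x1 x2 - C) <= dY (f x1) (f x2)
             /\ dY (f x1) (f x2) <= K * dX x1 x2 + C.

Definition quasi_isometry {X Y : Type}
    (dX : X -> X -> R) (dY : Y -> Y -> R) (f : X -> Y) : Prop :=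
  (exists K C : R,
     [/\ 1 <= K, 0 <= C & quasi_isometric_embedding dX dY f K C])
  /\ exists r : R, 0 < r /\ forall y, exists x, dY (f x) y < r.

Definition quasi_isometric_metrics {X : Type} (d d' : X -> X -> R) : Prop :=
  quasi_isometry d d' id.

Definition QI_class {X : Type} (d : X -> X -> R) : set (X -> X -> R) :=
  [set d' | is_metric d' /\ quasi_isometric_metrics d d'].

Definition restrict_metric {X : Type} (A : set X) (d : X -> X -> R) :
    A -> A -> R :=
  fun x y => d (set_val x) (set_val y).

Definition restrict_QI_class {X : Type} (A : set X) (C : set (X -> X -> R)) :
    set (A -> A -> R) :=
  \bigcup_(d in C) QI_class (@restrict_metric X A d).

Definition uniformly_discrete {X : Type} (d : X -> X -> R) (A : set X) : Prop :=
  exists r : R, 0 < r /\ forall x y, A x -> A y -> x <> y -> r <= d x y.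

Definition relatively_dense {X : Type} (d : X -> X -> R) (A : set X) : Prop :=
  exists r : R, 0 < r /\ forall g, exists x, A x /\ d g x < r.

Definition Delone {X : Type} (d : X -> X -> R) (A : set X) : Prop :=
  [/\ A !=set0, uniformly_discrete d A & relatively_dense d A].

End Metrics.

Section TopologicalGroups.
Context {R : realType} {G : topologicalGroupType}.

Definition lcsc : Prop :=
  [/\ hausdorff_space G, locally_compact [set: G] & @second_countable G].

Definition compact_generating_set (K : set G) : Prop :=
  compact K /\ generated K = [set: G].

Definition compactly_generated : Prop := exists K, compact_generating_set K.

Definition left_invariant (d : G -> G -> R) : Prop :=
  forall g x y, d (g * x)%g (g * y)%g = d x y.

Definition induces_topology (d : G -> G -> R) : Prop :=
  forall (x : G) (A : set G),
    nbhs x A <-> exists r : R, 0 < r /\ [set y | d x y < r] `<=` A.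

Definition proper_metric (d : G -> G -> R) : Prop :=
  forall (x : G) (r : R), compact [set y | d x y <= r].

Definition proper_left_invariant_metric (d : G -> G -> R) : Prop :=
  [/\ is_metric d, left_invariant d, induces_topology d & proper_metric d].

Definition uniform_approximate_lattice (d : G -> G -> R) (L : set G) : Prop :=
  approximate_subgroup L /\ Delone d L.

(* All word metrics with respect to compact generating sets of G are
   quasi-isometric, as are all word metrics with respect to finite generating
   sets of [generated L]; being "the" canonical class is thus expressed as being
   the class of one of these metrics. *)
Definition is_canonical_QI_class (C : set (G -> G -> R)) : Prop :=
  exists2 K, compact_generating_set K & C = QI_class (word_metric R K).

Definition is_canonical_QI_class_of (L : set G) (C : set (L -> L -> R)) : Prop :=
  exists2 S, finite_generating_set (generated L) S
           & C = QI_class (restrict_metric (A := L) (word_metric R S)).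

End TopologicalGroups.

Arguments lcsc G : clear implicits.
Arguments compactly_generated G : clear implicits.

(* Main.v *)
From HB Require Import structures.
Require Import Defs.
From mathcomp Require Import all_boot all_order all_algebra.
From mathcomp Require Import all_classical all_reals all_analysis.
From mathcomp Require Import lra.

Set Implicit Arguments.
Unset Strict Implicit.
Unset Printing Implicit Defensive.

Import Order.TTheory GRing.Theory Num.Theory.

Local Open Scope classical_set_scope.

(** Fix [r] such that every point of [G] is within [r] of [L], a compact
    generating set [K], and [M] bounding [d 1] on [K].  Follow a [K]-word from
    [x] to [y], both in [L], and replace each vertex of the path by a point of
    [L] within [r]: consecutive points then differ by an element of the set [S]
    of those [g] in [L^-1 L] with [d 1 g <= M + 2 r].  This set is finite, as
    [L^-1 L] lies in finitely many translates of the uniformly discrete set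
    [L].  So [S] generates the group generated by [L], and on [L] its word
    metric is at most that of [K] plus one.  Conversely, any finite generating
    set of that group has bounded [K]-length. *)

(** * Words and generated subgroups *)

Section Words.
Context {G : groupType}.
Implicit Types (S T H : set G) (g h : G) (s t : seq G).

Lemma words_cat S g h s t :
  words S g s -> words S h t -> words S (g * h)%g (s ++ t).
Proof.
move=> [Ss <-] [St <-]; split; last by rewrite big_cat.
by move=> x; rewrite mem_cat => /orP[/Ss|/St].
Qed.

Lemma words_inv S g s :
  words S g s -> words S (g^-1)%g (rev [seq (x^-1)%g | x <- s]).
Proof.
move=> [Ss <-]; split.
  move=> x; rewrite mem_rev => /mapP[y /Ss Sy ->]; rewrite invgK.
  by case: Sy; [right|left].
by rewrite -map_rev big_map prodgV revK.
Qed.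

Lemma words1 S x : S x -> words S x [:: x].
Proof.
move=> Sx; split; last by rewrite big_seq1.
by move=> y; rewrite inE => /eqP ->; left.
Qed.

Lemma words_nil S : words S 1%g [::].
Proof. by split=> //; rewrite big_nil. Qed.

Lemma words_cons S g x s :
  words S g (x :: s) -> (S x \/ S (x^-1)%g) /\ words S (x^-1 * g)%g s.
Proof.
move=> [Ss <-]; split; first by apply: Ss; rewrite mem_head.
split; last by rewrite big_cons mulKg.
by move=> y ys; apply: Ss; rewrite inE ys orbT.
Qed.

Lemma generated1 S : generated S 1%g.
Proof. by move=> A [[+ _] _]; rewrite inE. Qed.

Lemma generatedV S x : generated S x -> generated S (x^-1)%g.
Proof.
move=> Sx A [Agrp SA]; have Ax : A x by apply: Sx.
by apply/set_mem/group_closedV => //; rewrite inE.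
Qed.

Lemma generatedM S x y :
  generated S x -> generated S y -> generated S (x * y)%g.
Proof.
move=> Sx Sy A [Agrp SA].
have Ax : A x by apply: Sx.
have Ay : A y by apply: Sy.
by apply/set_mem/group_closedM => //; rewrite inE.
Qed.

Lemma generated_sub S T : S `<=` generated T -> generated S `<=` generated T.
Proof.
move=> ST; apply: smallest_sub => //; split; first by rewrite inE; apply: generated1.
by move=> x y; rewrite !inE => Tx Ty; apply: generatedM => //; apply: generatedV.
Qed.

(** The elements spelled by words form a subgroup containing [S]; conversely, the product of a word
    is built from elements of [S] by products and inverses. *)
Lemma generated_words S g : generated S g <-> words S g !=set0.
Proof.
split=> [Sg|[s]].
  apply: (Sg [set h | words S h !=set0]); split=> [|x Sx]; last by exists [:: x]; apply: words1.
  split; first by rewrite inE; exists [::]; apply: words_nil.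
  move=> x y; rewrite !inE => -[s xs] [t yt].
  by exists (s ++ rev [seq (z^-1)%g | z <- t]); apply/words_cat/words_inv.
elim: s g => [|x s IH] g; first by move=> [_ <-]; rewrite big_nil; apply: generated1.
move=> /words_cons[Sx /IH Sg]; rewrite -(mulVKg x g); apply: generatedM => //.
case: Sx => Sx; first exact: sub_gen_smallest.
by rewrite -(invgK x); apply: generatedV; apply: sub_gen_smallest.
Qed.

(** Each letter is replaced by a chosen [T]-word [w x]; as [S] is finite, these words have a maximal
    length, which serves as [C]. *)
Lemma words_rewrite S T : finite_set S -> S `<=` generated T ->
  exists C : nat, forall g s, words S g s ->
    exists2 t, words T g t & (size t <= C * size s)%N.
Proof.
move=> finS ST.
have /choice[w wP] : forall x, exists s, S x -> words T x s.
  move=> x; have [/ST/generated_words[s xs]|nSx] := pselect (S x).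
    by exists s.
  by exists [::].
have [e Se] : exists e : seq G, S = [set` e] by apply/finite_seqP.
exists (\max_(x <- e) size (w x)) => g s; set C := (\max_(x <- e) _)%N.
have leC x : S x -> (size (w x) <= C)%N.
  by rewrite Se => xe; apply: (@leq_bigmax_seq _ e xpredT (size \o w)).
elim: s g => [|x s IH] g.
  by move=> [_ <-]; exists [::]; rewrite ?big_nil //; apply: words_nil.
move=> /words_cons[Sx /IH[t tP tC]].
have [u uP uC] : exists2 u, words T x u & (size u <= C)%N.
  case: Sx => Sx; first by exists (w x); [apply: wP|apply: leC].
  (* If only the inverse of the letter is known to lie in [S], the chosen word of that inverse is
     inverted, which keeps its length. *)
  exists (rev [seq (z^-1)%g | z <- w (x^-1)%g]).
    by rewrite -[X in words T X]invgK; apply/words_inv/wP.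
  by rewrite size_rev size_map leC.
exists (u ++ t); first by rewrite -(mulVKg x g); apply: words_cat.
by rewrite size_cat mulnS leq_add.
Qed.

(** * Word metrics *)

Local Open Scope ring_scope.
Variable R : realType.

Lemma word_lengths_lbound S g : lbound [set ((size s)%:R : R) | s in words S g] 0.
Proof. by move=> _ [s _ <-]; rewrite ler0n. Qed.

Lemma word_metric_ge0 S x y : 0 <= word_metric R S x y.
Proof.
rewrite /word_metric; set E := (X in inf X).
(* If no word spells [x^-1 * y], the infimum takes its default value 0. *)
have [->|/set0P ne] := eqVneq E set0.
  by rewrite inf0.
by apply: lb_le_inf => //; apply: word_lengths_lbound.
Qed.

Lemma word_metric_le S x y s :
  words S (x^-1 * y)%g s -> word_metric R S x y <= (size s)%:R.
Proof.
by move=> ws; apply: ge_inf; [exists 0; apply: word_lengths_lbound|exists s].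
Qed.

(** Lengths are natural numbers, so a non-empty set of them has a least element. *)
Lemma word_metric_attained S x y : generated S (x^-1 * y)%g ->
  exists2 s, words S (x^-1 * y)%g s & word_metric R S x y = (size s)%:R.
Proof.
move=> /generated_words[s0 ws0].
pose P n := `[< exists2 s, words S (x^-1 * y)%g s & size s = n >].
have exP : exists n, P n by exists (size s0); apply/asboolP; exists s0.
have [n /asboolP[s ws sn] nmin] := ex_minnP exP.
exists s => //; apply/eqP; rewrite eq_le word_metric_le //=.
apply: lb_le_inf; first by exists (size s)%:R, s.
by move=> _ [t wt <-]; rewrite ler_nat sn nmin //; apply/asboolP; exists t.
Qed.

Lemma word_metricxx S x : word_metric R S x x = 0.
Proof.
apply/eqP; rewrite eq_le word_metric_ge0 andbT.
by apply: (@word_metric_le _ _ _ [::]); rewrite mulVg; apply: words_nil.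
Qed.

Lemma word_metric_is_metric S : generated S = setT -> is_metric (word_metric R S).
Proof.
move=> ST; have inS x y : generated S (x^-1 * y)%g by rewrite ST.
have sym x y : word_metric R S x y <= word_metric R S y x.
  have [s ws ->] := word_metric_attained (inS y x).
  have := words_inv ws; rewrite invgM invgK => /word_metric_le.
  by rewrite size_rev size_map.
split.
- by move=> x y; apply: word_metric_ge0.
- move=> x y; split=> [|->]; last exact: word_metricxx.
  have [s [_ ws] ->] := word_metric_attained (inS x y).
  move/eqP; rewrite pnatr_eq0 size_eq0 => /eqP s0; move: ws.
  by rewrite s0 big_nil => /esym/mulg1_eq; rewrite invgK.
- by move=> x y; apply/eqP; rewrite eq_le !sym.
- move=> x y z.
  have [s ws ->] := word_metric_attained (inS x y).
  have [t wt ->] := word_metric_attained (inS y z).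
  rewrite -natrD -size_cat; apply: word_metric_le.
  by rewrite -[(x^-1)%g](mulgK y) -mulgA; apply: words_cat.
Qed.

Lemma word_metric_finite_le S T : finite_set S -> S `<=` generated T ->
  exists2 C : R, 0 <= C & forall x y, generated S (x^-1 * y)%g ->
    word_metric R T x y <= C * word_metric R S x y.
Proof.
move=> finS /(words_rewrite finS)[C CP]; exists C%:R; first exact: ler0n.
move=> x y /word_metric_attained[s ws ->].
have [t wt tC] := CP _ _ ws.
by rewrite -natrM; apply: le_trans (word_metric_le wt) _; rewrite ler_nat.
Qed.

End Words.

(** * Coarse comparison of metrics *)

Section QuasiIsometries.
Local Open Scope ring_scope.
Context {R : realType} {X : Type}.
Implicit Types (d : X -> X -> R).

(** One half of being quasi-isometric through the identity. Each direction has its own constants,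
    with no lower bound 1 on [K], so that halves compose freely. *)
Definition coarsely_dominated d d' : Prop :=
  exists K C, [/\ 0 <= K, 0 <= C & forall x y, d x y <= K * d' x y + C].

Lemma coarsely_dominated_refl d : coarsely_dominated d d.
Proof. by exists 1, 0; split=> // x y; rewrite mul1r addr0. Qed.

Lemma coarsely_dominated_trans d1 d2 d3 :
  coarsely_dominated d1 d2 -> coarsely_dominated d2 d3 -> coarsely_dominated d1 d3.
Proof.
move=> [K [C [K0 C0 d12]]] [K' [C' [K'0 C'0 d23]]].
exists (K * K'), (K * C' + C); split; rewrite ?addr_ge0 ?mulr_ge0 // => x y.
apply: le_trans (d12 x y) _; rewrite addrA lerD2r -mulrA -mulrDr.
exact: ler_wpM2l.
Qed.

Lemma quasi_isometric_metricsE d d' :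
  (forall x y, 0 <= d x y) -> (forall x y, 0 <= d' x y) -> (forall x, d' x x = 0) ->
  quasi_isometric_metrics d d' <-> coarsely_dominated d d' /\ coarsely_dominated d' d.
Proof.
move=> d0 d'0 d'xx; split.
  move=> [[K [C [K1 C0 KC]]] _]; have K0 : 0 < K by apply: lt_le_trans K1.
  split; exists K, C; split; rewrite ?(ltW K0)// => x y; have [+ ub] := KC x y => //.
  by rewrite ler_pdivrMl // lerBlDr.
move=> [[K [C [K0 C0 dd']]] [K' [C' [K'0 C'0 d'd]]]]; split; last first.
  by exists 1; split=> // y; exists y; rewrite d'xx.
(* [M] is at least 1 and exceeds all four constants, so it can be both the factor and the additive
   constant in both directions. *)
pose M := 1 + K + K' + C + C'; have M0 : 0 < M by rewrite /M; lra.
have ME e b a c : 0 <= e -> a <= b * e + c -> b <= M -> c <= M -> a <= M * e + M.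
  by move=> e0 ae bM cM; apply: le_trans ae _; apply: lerD => //; apply: ler_wpM2r.
exists M, M; split; [by rewrite /M; lra|exact: ltW|] => x y; split.
  by rewrite ler_pdivrMl // lerBlDr; apply: ME (dd' x y) _ _; rewrite /M //; lra.
by apply: ME (d'd x y) _ _; rewrite /M //; lra.
Qed.

End QuasiIsometries.

(** * Restriction of QI classes *)

Section Metrics.
Local Open Scope ring_scope.
Context {R : realType}.

Lemma restrict_is_metric {X : Type} (A : set X) (d : X -> X -> R) :
  is_metric d -> is_metric (restrict_metric (A := A) d).
Proof.
move=> [d0 dxx dC dD]; split=> [x y|x y|x y|x y z]; rewrite /restrict_metric //.
by split=> [/dxx/val_inj //|->]; apply/dxx.
Qed.

Lemma coarsely_dominated_restrict {X : Type} (A : set X) (d d' : X -> X -> R) :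
  coarsely_dominated d d' ->
  coarsely_dominated (restrict_metric (A := A) d) (restrict_metric (A := A) d').
Proof. by move=> [K [C [K0 C0 dd']]]; exists K, C; split=> // x y; apply: dd'. Qed.

(** Comparing one representative of each class suffices: any other [d'] in the class of [d] is
    linked to [e] by restricting its comparison with [d] to [A]. *)
Lemma restrict_QI_classE {X : Type} (A : set X) (d : X -> X -> R) (e : A -> A -> R) :
  is_metric d -> (forall x y, 0 <= e x y) ->
  coarsely_dominated (restrict_metric (A := A) d) e ->
  coarsely_dominated e (restrict_metric (A := A) d) ->
  restrict_QI_class (A := A) (QI_class d) = QI_class e.
Proof.
move=> md e0 de ed; have rd := @restrict_is_metric _ A _ md.
have mge0 Y (f : Y -> Y -> R) : is_metric f -> forall x y, 0 <= f x y by case.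
have mxx Y (f : Y -> Y -> R) : is_metric f -> forall x, f x x = 0.
  by move=> [_ fxx _ _] x; apply/fxx.
have QIE Y (f g : Y -> Y -> R) (f0 : forall x y, 0 <= f x y) (mg : is_metric g) :=
  @quasi_isometric_metricsE _ Y f g f0 (mge0 _ _ mg) (mxx _ _ mg).
apply/seteqP; split=> f.
  move=> [d' [md' /(QIE _ _ _ (mge0 _ _ md) md')[dd' d'd]] [mf]].
  move/(QIE _ _ _ (mge0 _ _ (@restrict_is_metric _ A _ md')) mf) => [d'f fd'].
  split=> //; apply/QIE => //; split.
    apply: coarsely_dominated_trans ed _.
    exact: coarsely_dominated_trans (@coarsely_dominated_restrict _ A _ _ dd') d'f.
  apply: coarsely_dominated_trans de.
  exact: coarsely_dominated_trans fd' (@coarsely_dominated_restrict _ A _ _ d'd).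
move=> [mf /(QIE _ _ _ e0 mf)[ef fe]]; exists d.
  by split=> //; apply/(QIE _ _ _ (mge0 _ _ md) md); split; exact: coarsely_dominated_refl.
split=> //; apply/(QIE _ _ _ (mge0 _ _ rd) mf); split.
  exact: coarsely_dominated_trans de ef.
exact: coarsely_dominated_trans fe ed.
Qed.

End Metrics.

(** * Compactness and discreteness in a proper left-invariant metric *)

Section MetricGroups.
Local Open Scope ring_scope.
Context {R : realType} {G : topologicalGroupType}.
Variable d : G -> G -> R.
Hypothesis hd : proper_left_invariant_metric d.

Lemma compact_totally_bounded (C : set G) (e : R) : compact C -> 0 < e ->
  exists2 D : set G, finite_set D & C `<=` \bigcup_(x in D) [set y | d x y < e].
Proof.
move=> cC e0; have [[_ dxx _ _] _ dtop _] := hd.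
(* [compact_cover] is only available for pointed spaces. *)
pose T : ptopologicalType :=
  HB.pack (TopologicalGroup.sort G) (isPointed.Build G 1%g).
have : @cover_compact T C by rewrite -compact_cover.
move=> /(_ G setT (fun x => [set y | d x y < e]°)).
case.
- by move=> x _; apply: open_interior.
- by move=> y _; exists y => //; apply/dtop; exists e; split.
- move=> D _ DC; eexists; first exact: (finite_fset D).
  by move=> y /DC[x Dx /interior_subset dxy]; exists x.
Qed.

Lemma compact_bounded (C : set G) : compact C ->
  exists2 M : R, 0 <= M & forall y, C y -> d 1%g y <= M.
Proof.
move=> /compact_totally_bounded/(_ ltr01)[_ /finite_seqP[D ->] DC].
have [[d0 _ _ dD] _ _ _] := hd.
(* The sum bounds the distance from 1 to every centre in [D]; the final 1 is the radius of the
   balls. *)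
exists (\sum_(x <- D) d 1%g x + 1).
  by rewrite addr_ge0 // sumr_ge0.
move=> y /DC[x /= xD /ltW dxy]; apply: le_trans (dD _ x _) _; apply: lerD => //.
by rewrite (big_rem x) //= lerDl sumr_ge0.
Qed.

(** Finitely many balls of radius [r / 2] cover [C], and each contains at most one point of [A]. *)
Lemma uniformly_discrete_compact_finite (A C : set G) :
  uniformly_discrete d A -> compact C -> finite_set (A `&` C).
Proof.
move=> [r [r0 Ar]] cC; have [[_ _ dC dD] _ _ _] := hd.
have [|D finD DC] := @compact_totally_bounded _ (r / 2) cC; first by rewrite divr_gt0.
apply: (@sub_finite_set _ _ (\bigcup_(x in D) (A `&` [set y | d x y < r / 2]))).
  by move=> y [Ay /DC[x xD dxy]]; exists x.
apply: bigcup_finite => // x _.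
set B := (_ `&` _); have [->|/set0P[y [Ay /= dxy]]] := eqVneq B set0; first exact: finite_set0.
apply: (@sub_finite_set _ _ [set y]); last exact: finite_set1.
move=> z [Az /= dxz]; apply: contrapT => zy; have := Ar _ _ Az Ay zy.
by rewrite leNgt => /negP; apply; apply: le_lt_trans (dD _ x _) _; rewrite dC; lra.
Qed.

Definition small_differences (L : set G) (rho : R) : set G :=
  [set g | exists x y, [/\ L x, L y, g = (x^-1 * y)%g & d 1%g g <= rho]].

(** By symmetry [g] lies in [L L], so [g = f * z] with [f] in the finite set [F] and [z] in [L].
    Left invariance puts [z] in the closed [rho]-ball around [f^-1], which is compact. *)
Lemma small_differences_finite (L : set G) (rho : R) :
  approximate_subgroup L -> uniformly_discrete d L ->
  finite_set (small_differences L rho).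
Proof.
move=> [LV _ [F [finF _ LLF]]] dL; have [_ dinv _ dproper] := hd.
pose P f := L `&` [set y | d (f^-1)%g y <= rho].
apply: (@sub_finite_set _ _ (\bigcup_(f in F) ((fun y => f * y)%g @` P f))).
  move=> g [x [y [Lx Ly gE dg]]].
  have [|f Ff [z Lz fz]] := LLF g; first by rewrite gE; exists (x^-1)%g; [exact: LV|exists y].
  exists f => //; exists z => //; split=> //=.
  by rewrite -(dinv f) mulgV fz.
apply: bigcup_finite => // f _; apply: finite_image.
by apply: uniformly_discrete_compact_finite => //; apply: dproper.
Qed.

(** * Shadowing a path by points of [L] *)

Section Shadowing.
Variables (K L : set G) (r M : R).
Hypothesis Lr : forall g, exists x, L x /\ d g x < r.
Hypothesis M0 : 0 <= M.
Hypothesis KM : forall k, K k -> d 1%g k <= M.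

(** The current vertex [h] of the path may leave [L], so the induction carries its shadow [x] along.
    Each letter costs one step between shadows; the extra letter joins the last shadow to [y]. *)
Lemma shadow_words (h x y : G) (s : seq G) :
  L x -> L y -> d h x < r -> words K (h^-1 * y)%g s ->
  exists2 t, words (small_differences L (r + M + r)) (x^-1 * y)%g t
           & (size t <= (size s).+1)%N.
Proof.
have [[d0 _ dC dD] dinv _ _] := hd.
have diff_small a b : d 1%g (a^-1 * b)%g = d a b by rewrite -(dinv a) mulg1 mulVKg.
move=> + Ly; elim: s h x => [|k s IH] h x Lx hx.
  move=> [_]; rewrite big_nil => /esym/mulg1_eq; rewrite invgK => hy; subst h.
  exists [:: (x^-1 * y)%g] => //; apply: words1; exists x, y; split=> //.
  rewrite diff_small dC; have := d0 y x; move: hx M0; lra.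
move=> /words_cons[Kk]; rewrite mulgA -invgM => ws.
have dk : d 1%g k <= M.
  by case: Kk => [/KM//|/KM]; rewrite -(dinv k) mulg1 mulgV dC.
have [x' [Lx' hx']] := Lr (h * k)%g.
have [t wt st] := IH _ _ Lx' hx' ws.
exists ((x^-1 * x')%g :: t) => //.
have -> : (x^-1 * y = (x^-1 * x') * (x'^-1 * y))%g by rewrite mulgA mulgK.
rewrite -cat1s; apply: words_cat => //; apply: words1.
exists x, x'; split=> //; rewrite diff_small.
(* The route from [x] through [h] and [h * k] to [x'] has legs bounded by [r], [M] and [r]. *)
have := dD x h x'; have := dD h (h * k)%g x'.
have : d h (h * k)%g = d 1%g k by rewrite -{1}(mulg1 h) dinv.
rewrite (dC x h); lra.
Qed.

End Shadowing.
End MetricGroups.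

(** * Finite generation and equality of the QI classes *)

Theorem theorem1p13 (R : realType) (G : topologicalGroupType)
    (lcscG : lcsc G) (cgG : compactly_generated G)
    (d : G -> G -> R) (hd : proper_left_invariant_metric d)
    (L : set G) (hL : uniform_approximate_lattice d L) :
  finitely_generated (generated L)
  /\ forall (CG : set (G -> G -> R)) (CL : set (L -> L -> R)),
       is_canonical_QI_class CG -> is_canonical_QI_class_of CL ->
       restrict_QI_class (A := L) CG = CL.
Proof.
have [appL [_ udL [r [r0 Lr]]]] := hL; have [LV L1 _] := appL.
have [[d0 dxx _ _] _ _ _] := hd.
(* [K] stays arbitrary: some [K] gives finite generation, while the comparison of classes uses the
   [K] that defines [CG]. *)
have step K : compact_generating_set K -> exists S : set G,
    finite_generating_set (generated L) S /\
    forall x y, L x -> L y ->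
      (word_metric R S x y <= word_metric R K x y + 1)%R.
  move=> [cK KG]; have [M M0 KM] := compact_bounded hd cK.
  pose S := small_differences d L (r + M + r)%R.
  have shadow x y s : L x -> L y -> words K (x^-1 * y)%g s ->
      exists2 t, words S (x^-1 * y)%g t & (size t <= (size s).+1)%N.
    (* The path starts at [x], which is its own shadow. *)
    move=> Lx Ly; apply: (shadow_words hd Lr M0 KM) => //.
    by have /dxx -> : x = x by [].
  have KT x : generated K x by rewrite KG.
  exists S; split; last first.
    move=> x y Lx Ly; have [s ws ->] := word_metric_attained R (KT (x^-1 * y)%g).
    have [t wt st] := shadow _ _ _ Lx Ly ws.
    by apply: le_trans (word_metric_le R wt) _; rewrite natr1 ler_nat.
  split; first exact: small_differences_finite.
  apply/seteqP; split; apply: generated_sub.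
    move=> _ [x [y [Lx Ly -> _]]].
    by apply: generatedM; [apply: generatedV|]; apply: sub_gen_smallest.
  (* As 1 lies in [L], a [K]-path from 1 to [x] can be shadowed, which spells [x] in [S]. *)
  move=> x Lx; have [s] : words K (1^-1 * x)%g !=set0 by apply/generated_words.
  move=> /(shadow _ _ _ L1 Lx)[t]; rewrite invg1 mul1g => wt _.
  by apply/generated_words; exists t.
split; first by have [K /step[S [SL _]]] := cgG; exists S.
move=> CG CL [K cK ->] [S [finS SL] ->].
(* The given [S] need not consist of small differences, so it is compared with [K] through the set
   [S0] built from [K]. *)
have [S0 [[finS0 S0L] S0K]] := step K cK; have KT := cK.2.
have genL x y : L x -> L y -> generated L (x^-1 * y)%g.
  by move=> Lx Ly; apply: generatedM; [apply: generatedV|]; apply: sub_gen_smallest.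
have [|C C0 SK] := @word_metric_finite_le _ R S K finS; first by rewrite KT.
have [|C' C'0 S0S] := @word_metric_finite_le _ R S0 S finS0.
  by rewrite SL -S0L; apply: sub_gen_smallest.
apply: restrict_QI_classE.
- exact: word_metric_is_metric.
- by move=> x y; apply: word_metric_ge0.
- exists C, 0%R; split=> // x y; rewrite addr0; apply: SK.
  by rewrite SL; apply: genL; apply/set_mem/valP.
(* The additive [C'] is the shadowing error 1 scaled by the factor for passing from [S0] to [S]. *)
- exists C', C'; split=> // x y; have Lx := set_valP x; have Ly := set_valP y.
  apply: le_trans (S0S _ _ _) _; first by rewrite S0L; apply: genL.
  by rewrite -{3}[C']mulr1 -mulrDr; apply: ler_wpM2l => //; apply: S0K.
Qed.
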